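(* Let $M\subseteq\mathbb{T}$ satisfy the standing hypothesis. The complete shell $\mathrm{shell}_{\curvearrowleft}(\rho^\forall_M)$ of the universal closure for time reversal exists, its set of fixpoints is the closure under arbitrary unions of $\{Y\mid Y\text{ a fixpoint of }\rho^\forall_M\}\cup\{Y\subseteq\mathbb{T}\mid\curvearrowleft Y\text{ is a fixpoint of }\rho^\forall_M\}$, and $\mathrm{shell}_{\curvearrowleft}(\rho^\forall_M)=\rho^\forall_M\sqcap\rho^\forall_{\curvearrowleft M}$.
   Context: $\mathbb{T}$ is the set of traces $\langle i,\sigma\rangle$, $i\in\mathbb{Z}$, $\sigma:\mathbb{Z}\to\mathbb{S}$; $X_{\downarrow s}=\{\langle i,\sigma\rangle\in X\mid\sigma_i=s\}$; $\oplus(X)=\{\langle i,\sigma\rangle\mid\langle i+1,\sigma\rangle\in X\}$, $\ominus(X)=\{\langle i,\sigma\rangle\mid\langle i-1,\sigma\rangle\in X\}$, $\curvearrowleft(X)=\{\langle -i,\lambda k.\sigma_{-k}\rangle\mid\langle i,\sigma\rangle\in X\}$. Standing hypothesis on $M$: (i) $|M_{\downarrow s}|>1$ for all $s$; (ii) $\oplus(M)=M=\ominus(M)$ and $\oplus(\curvearrowleft M)=\curvearrowleft M=\ominus(\curvearrowleft M)$. For a model $N$, $\rho^\forall_N(X)=\{\langle i,\sigma\rangle\in N\mid N_{\downarrow\sigma_i}\subseteq X\}$. Upper closure operators on $\langle\wp(\mathbb{T}),\supseteq\rangle$: maps monotone w.r.t. $\subseteq$, idempotent, with $\rho(X)\subseteq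 X$; ordered by $\rho\sqsubseteq\eta$ iff $\rho(X)\supseteq\eta(X)$ for all $X$; identified with their sets of fixpoints; the glb $\rho\sqcap\eta$ is the closure whose set of fixpoints is the closure under arbitrary unions of the union of their sets of fixpoints (equivalently $(\rho\sqcap\eta)(X)=\rho(X)\cup\eta(X)$). $\rho$ is complete for $f$ if $\rho\circ f=\rho\circ f\circ\rho$. The complete shell of $\rho$ for $f$ is the $\sqsubseteq$-greatest closure $\eta\sqsubseteq\rho$ complete for $f$. *)

(* Defs.v *)
From mathcomp Require Import all_boot all_order all_algebra.
From mathcomp Require Import boolp classical_sets functions cardinality.

Set Implicit Arguments.
Unset Strict Implicit.
Unset Printing Implicit Defensive.

Import Order.TTheory GRing.Theory Num.Theory.

Local Open Scope classical_set_scope.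
Local Open Scope card_scope.
Local Open Scope ring_scope.

Definition trace (S : Type) : Type := (int * (int -> S))%type.

Section Traces.
Variable S : Type.
Implicit Types (X M N : set (trace S)) (s : S).

Definition present_state (t : trace S) : S := t.2 t.1.

Definition current X s : set (trace S) := [set t | X t /\ present_state t = s].

Definition next_time X : set (trace S) := [set t | X (t.1 + 1, t.2)].

Definition prev_time X : set (trace S) := [set t | X (t.1 - 1, t.2)].

Definition rev_trace (t : trace S) : trace S := (- t.1, fun k => t.2 (- k)).

Definition reversal X : set (trace S) := rev_trace @` X.

Definition univ_closure N X : set (trace S) :=
  [set t | N t /\ current N (present_state t) `<=` X].

Record standing_hypothesis M : Prop := StandingHypothesis {
  (* the cardinality of [current M s] is not <= 1 *)
  sh_card : forall s, ~~ (current M s #<= `I_1) ;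
  sh_next : next_time M = M ;
  sh_prev : prev_time M = M ;
  sh_next_rev : next_time (reversal M) = reversal M ;
  sh_prev_rev : prev_time (reversal M) = reversal M
}.

End Traces.

Section Closures.
Variable T : Type.
Implicit Types (rho eta : set T -> set T) (C : set (set T)).

(* Upper closure operators on the powerset of T ordered by REVERSE inclusion:
   extensivity therefore reads [rho X `<=` X]. *)
Record is_uco rho : Prop := IsUco {
  uco_mono : forall X Y, X `<=` Y -> rho X `<=` rho Y ;
  uco_idem : forall X, rho (rho X) = rho X ;
  uco_ext : forall X, rho X `<=` X
}.

Definition uco_le rho eta : Prop := forall X, eta X `<=` rho X.

Definition fixpoints rho : set (set T) := [set Y | rho Y = Y].

(* The empty family is allowed, so [set0] always belongs to the closure. *)
Definition union_closure C : set (set T) :=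
  [set Y | exists2 F : set (set T), F `<=` C & Y = \bigcup_(Z in F) Z].

(* For C closed under arbitrary unions, the unique closure operator whose set
   of fixpoints is C; see [uco_of_fixpoints] and [fixpointsK]. *)
Definition uco_of C (X : set T) : set T :=
  \bigcup_(Y in [set Y | C Y /\ Y `<=` X]) Y.

Definition uco_glb rho eta : set T -> set T :=
  uco_of (union_closure (fixpoints rho `|` fixpoints eta)).

Definition complete_for (f rho : set T -> set T) : Prop :=
  rho \o f = rho \o f \o rho.

Definition is_complete_shell (f rho eta : set T -> set T) : Prop :=
  [/\ is_uco eta, uco_le eta rho, complete_for f eta &
      forall kappa, is_uco kappa -> uco_le kappa rho -> complete_for f kappa ->
        uco_le kappa eta].

Lemma union_closure_idem C F :
  F `<=` union_closure C -> union_closure C (\bigcup_(Z in F) Z).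
Proof.
move=> FC; exists [set Z | C Z /\ Z `<=` \bigcup_(Y in F) Y]; first by move=> Z [].
apply/seteqP; split=> [t [Y FY Yt]|t [Z [_ ZF] Zt]]; last exact: ZF.
have [G GC YE] := FC _ FY; move: (Yt); rewrite YE => -[Z GZ Zt].
exists Z => //; split; first exact: GC.
by move=> u Zu; exists Y => //; rewrite YE; exists Z.
Qed.

Lemma is_uco_of C : is_uco (uco_of C).
Proof.
split=> [X Y XY t [Z [CZ ZX] Zt]|X|X t [Z [_ ZX] Zt]]; last exact: ZX.
- by exists Z => //; split=> //; apply: subset_trans XY.
- apply/seteqP; split=> [t [Z [CZ ZX] Zt]|t [Z [CZ ZX] Zt]]; first exact: ZX.
  by exists Z => //; split=> // u Zu; exists Z.
Qed.

Lemma uco_of_fixpoints C :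
  fixpoints (uco_of (union_closure C)) = union_closure C.
Proof.
apply/seteqP; split=> [Y /= <-|Y CY /=]; first by apply: union_closure_idem => Z [].
apply/seteqP; split=> [t [Z [_ ZY] Zt]|t Yt]; first exact: ZY.
by exists Y; first by split.
Qed.

Lemma fixpointsK rho : is_uco rho -> uco_of (fixpoints rho) = rho.
Proof.
case=> mono idem ext; apply/funext => X; apply/seteqP; split.
  by move=> t [Y [YE YX] Yt]; apply: (mono _ _ YX); rewrite YE.
by move=> t Xt; exists (rho X) => //; split; [exact: idem|exact: ext].
Qed.

Lemma uco_glbE rho eta : is_uco rho -> is_uco eta ->
  uco_glb rho eta = fun X => rho X `|` eta X.
Proof.
move=> ur ue; apply/funext => X; apply/seteqP; split.
  move=> t [Y [[F FC ->] YX] [Z FZ Zt]].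
  have ZX : Z `<=` X by apply: subset_trans YX => u Zu; exists Z.
  by case: (FC _ FZ) => /= ZE; [left|right];
     [apply: (uco_mono ur ZX)|apply: (uco_mono ue ZX)]; rewrite ZE.
have sub Y : (fixpoints rho `|` fixpoints eta) Y -> Y `<=` X ->
    Y `<=` uco_glb rho eta X.
  move=> CY YX t Yt; exists Y => //; split=> //.
  by exists [set Y]; [move=> _ ->|rewrite bigcup_set1].
move=> t [Xt|Xt].
- by apply: (sub (rho X)) Xt; [left; exact: uco_idem|exact: uco_ext].
- by apply: (sub (eta X)) Xt; [right; exact: uco_idem|exact: uco_ext].
Qed.

End Closures.

Lemma univ_closure_uco (S : Type) (N : set (trace S)) :
  is_uco (univ_closure N).
Proof.
split=> [X Y XY t [Nt sX]|X|X t [Nt]]; last by apply.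
- by split=> // u /sX /XY.
- apply/seteqP; split=> [t [Nt sX]|t [Nt sX]]; first exact: sX.
  by split=> // u [Nu su]; split=> //; rewrite su.
Qed.

(* Main.v *)
Require Import Defs.
From mathcomp Require Import all_boot all_order all_algebra.
From mathcomp Require Import boolp classical_sets functions cardinality.

Set Implicit Arguments.
Unset Strict Implicit.
Unset Printing Implicit Defensive.

Local Open Scope classical_set_scope.

(** Let [f] be the action of an involution on sets.  For a closure [rho], its
    conjugate [f rho f] is a closure, and the meet of the two commutes with [f],
    hence is complete for [f].  Conversely, if [kappa] lies below [rho] and is
    complete for [f], then [rho (f X) `<=` kappa (f X) = kappa (f (kappa X))
    `<=` f (kappa X)], and applying [f] shows that [kappa] lies below the
    conjugate as well.  Time reversal is such an involution; it preserves the
    present state, so conjugating the universal closure of [M] gives the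
    universal closure of the reversed model. *)

Section InvolutionShell.
Variables (T : Type) (g : T -> T).
Hypothesis gK : involutive g.
Local Notation f := (fun X : set T => g @` X).

Lemma image_involutive : involutive f.
Proof.
by move=> X; rewrite image_comp -[RHS]image_id; congr image; exact/funext.
Qed.

Variable rho : set T -> set T.
Hypothesis rho_uco : is_uco rho.
Local Notation conj := (f \o rho \o f).

Lemma conj_uco : is_uco conj.
Proof.
have [mono idem ext] := rho_uco; split=> [X Y XY|X|X] /=.
- by apply: image_subset; apply: mono; exact: image_subset.
- by rewrite image_involutive idem.
- rewrite -[Z in _ `<=` Z]image_involutive; apply: image_subset; exact: ext.
Qed.

(** Since [f] is its own inverse, [f (rho (f Y)) = Y] amounts to [rho (f Y) = f Y]. *)
Lemma fixpoints_conj : fixpoints conj = [set Y | fixpoints rho (f Y)].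
Proof.
rewrite /fixpoints; apply/seteqP; split=> Y /= E; last by rewrite E image_involutive.
by rewrite -[in RHS]E image_involutive.
Qed.

Lemma complete_shell_involution : is_complete_shell f rho (uco_glb rho conj).
Proof.
have comm X : uco_glb rho conj (f X) = f (uco_glb rho conj X).
  (* [f] swaps the two members of the union: [f (rho X)] is [conj (f X)] and [f (conj X)] is
     [rho (f X)]. *)
  by rewrite (uco_glbE rho_uco conj_uco) image_setU /= !image_involutive setUC.
have glb_uco : is_uco (uco_glb rho conj) by exact: is_uco_of.
split=> //.
- by rewrite (uco_glbE rho_uco conj_uco) => X; left.
(* Given commutation with [f], completeness reduces to idempotence. *)
- by apply/funext => X /=; rewrite !comm (uco_idem glb_uco).
move=> kappa kappa_uco le_kr compl X; rewrite (uco_glbE rho_uco conj_uco).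
rewrite subUset; split; first exact: le_kr.
rewrite -[kappa X]image_involutive; apply: image_subset.
apply: subset_trans (le_kr _) _.
have /= -> := congr1 (@^~ X) compl.
exact: uco_ext.
Qed.

End InvolutionShell.

Lemma rev_traceK (S : Type) : involutive (@rev_trace S).
Proof.
move=> [i s]; rewrite /rev_trace /= GRing.opprK; congr pair.
by apply/funext => k; rewrite GRing.opprK.
Qed.

Lemma present_state_rev (S : Type) (t : trace S) :
  present_state (rev_trace t) = present_state t.
Proof. by rewrite /present_state /= GRing.opprK. Qed.

(** The image under an involution is also the preimage, which spares existential witnesses. *)
Lemma reversalE (S : Type) (X : set (trace S)) t :
  reversal X t = X (rev_trace t).
Proof.
apply/propext; split=> [[u Xu <-]|Xt]; first by rewrite rev_traceK.
by exists (rev_trace t) => //; rewrite rev_traceK.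
Qed.

Lemma univ_closure_reversal (S : Type) (M : set (trace S)) :
  univ_closure (reversal M) = @reversal S \o univ_closure M \o @reversal S.
Proof.
apply/funext => X; apply/funext => t /=.
rewrite reversalE; apply/propext; split=> -[Mt sub]; split.
- by rewrite -reversalE.
- move=> u [Mu su]; rewrite reversalE; apply: sub.
  by split; rewrite ?reversalE ?rev_traceK // present_state_rev su
    present_state_rev.
- by rewrite reversalE.
- move=> u [Mu su]; rewrite -[u]rev_traceK -reversalE; apply: sub.
  by split; rewrite -?reversalE // !present_state_rev.
Qed.

Theorem theorem12 (S : Type) (M : set (trace S))
    (hM : standing_hypothesis M) :
  exists shell : set (trace S) -> set (trace S),
    [/\ is_complete_shell (@reversal S) (univ_closure M) shell,
        fixpoints shell =
          union_closure (fixpoints (univ_closure M) `|`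
                         [set Y | fixpoints (univ_closure M) (reversal Y)]) &
        shell = uco_glb (univ_closure M) (univ_closure (reversal M))].
Proof.
exists (uco_glb (univ_closure M) (univ_closure (reversal M))).
rewrite univ_closure_reversal; split=> //.
- exact: (complete_shell_involution (@rev_traceK S) (univ_closure_uco M)).
(* The meet is [uco_of] a union closure, which is thus its set of fixpoints; only those of the
   conjugate remain to be identified. *)
- rewrite /uco_glb uco_of_fixpoints.
  by rewrite (fixpoints_conj (@rev_traceK S) (univ_closure M)).
Qed.
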